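(* Let $G$ and $H$ be graphs and let $k,\ell$ be positive integers. Then $$\left\lceil \frac{\Delta(H)+|V(H)|\Delta(G)}{2}\right\rceil\leq {\rm la}_{\max\{k,\ell\}}(G\circ H)\leq {\rm la}_{k}(G)\,|V(H)|+{\rm la}_{\ell}(H).$$ Moreover, the bounds are sharp.
   Context: All graphs are finite, simple and undirected; $\Delta(G)$ denotes the maximum degree. A linear $k$-forest is a forest each of whose components is a path of length (number of edges) at most $k$. The linear $k$-arboricity ${\rm la}_k(G)$ of a graph $G$ is the least number of linear $k$-forests (subgraphs of $G$) whose edge sets partition $E(G)$. The lexicographic product $G\circ H$ has vertex set $V(G)\times V(H)$, with $(u,v)$ adjacent to $(u',v')$ iff $uu'\in E(G)$, or $u=u'$ and $vv'\in E(H)$. *)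

(* Defs.v *)
From mathcomp Require Import all_boot.
From mathcomp Require Import boolp.

Set Implicit Arguments.
Unset Strict Implicit.
Unset Printing Implicit Defensive.

Record sgraph (V : finType) := SGraph {
  adj :> rel V;
  adj_sym : symmetric adj;
  adj_irr : irreflexive adj
}.

Section Graphs.
Variable V : finType.
Implicit Types G F : sgraph V.

Definition maxdeg G : nat := \max_(x : V) #|[set y | adj G x y]|.

Definition edges G : {set {set V}} :=
  [set [set p.1; p.2] | p : V * V & adj G p.1 p.2].

Definition acyclic G : Prop :=
  forall c : seq V, ucycle (adj G) c -> size c <= 2.

Definition component G (x : V) : {set V} := [set y | connect (adj G) x y].

(* The subgraph of G induced on C is the path visiting the vertices of s in
   order; it has (size s).-1 edges. *)
Definition is_path_le (k : nat) G (C : {set V}) : Prop :=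
  exists s : seq V,
    [/\ uniq s, s =i C, (size s).-1 <= k &
        {in C &, forall y z, adj G y z =
           (index z s == (index y s).+1) || (index y s == (index z s).+1)}].

Definition linear_forest (k : nat) F : Prop :=
  acyclic F /\ forall x : V, is_path_le k F (component F x).

(* The parts are spanning subgraphs of G: a vertex missed by a linear k-forest
   can be added to it as a path of length 0. A part may have no edge. *)
Definition linear_decomposition (k : nat) G (n : nat) : Prop :=
  exists F : 'I_n -> sgraph V,
    [/\ forall i, linear_forest k (F i),
        forall i j, i != j -> [disjoint edges (F i) & edges (F j)] &
        \bigcup_(i < n) edges (F i) = edges G].

(* The least n admitting a decomposition. One exists whenever k > 0 (see laP); the
   value 0 is a default for k = 0 and a graph with edges. *)
Definition la (k : nat) G : nat :=
  match pselect (exists n, `[< linear_decomposition k G n >]) with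
  | left exn => ex_minn exn
  | right _ => 0
  end.

End Graphs.

Section LexicographicProduct.
Variables (V W : finType) (G : sgraph V) (H : sgraph W).

Definition lex_rel : rel (V * W) := fun p q =>
  adj G p.1 q.1 || (p.1 == q.1) && adj H p.2 q.2.

Lemma lex_sym : symmetric lex_rel.
Proof. by move=> p q; rewrite /lex_rel adj_sym eq_sym [adj H _ _]adj_sym. Qed.

Lemma lex_irr : irreflexive lex_rel.
Proof. by move=> p; rewrite /lex_rel !adj_irr andbF. Qed.

Definition lex_prod : sgraph (V * W)%type := SGraph lex_sym lex_irr.

End LexicographicProduct.

Section LaSpec.
Variable V : finType.
Implicit Types G F : sgraph V.

Lemma in_edges G x y : ([set x; y] \in edges G) = adj G x y.
Proof.
apply/imsetP/idP => [[[a b] /= ab e]|xy]; last by exists (x, y); rewrite ?inE.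
rewrite inE /= in ab.
have hab : a != b by apply: contraTneq ab => ->; rewrite adj_irr.
have := set22 a b; have := set21 a b; rewrite -e !inE.
by case/orP=> /eqP ea; case/orP=> /eqP eb; subst a b;
  rewrite ?eqxx // in hab *; rewrite // adj_sym.
Qed.

Section SingleEdge.
Variables (G : sgraph V) (E : {set V}).

Definition edge_rel : rel V := fun x y => adj G x y && ([set x; y] == E).

Lemma edge_rel_sym : symmetric edge_rel.
Proof. by move=> x y; rewrite /edge_rel adj_sym setUC. Qed.

Lemma edge_rel_irr : irreflexive edge_rel.
Proof. by move=> x; rewrite /edge_rel adj_irr. Qed.

Definition edge_graph : sgraph V := SGraph edge_rel_sym edge_rel_irr.

Lemma edge_rel_nbr x y z : edge_rel x y -> edge_rel y z -> z = x.
Proof.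
case/andP=> xy /eqP e1 /andP[yz /eqP e2].
have := set22 y z; rewrite e2 -e1 !inE => /orP[/eqP // | /eqP ezy].
by rewrite ezy adj_irr in yz.
Qed.

Lemma edges_edge_graph : E \in edges G -> edges edge_graph = [set E].
Proof.
move=> /imsetP[[a b]]; rewrite inE /= => ab eE.
apply/setP => S; rewrite inE; apply/imsetP/eqP => [[[c d]]|->].
  by rewrite inE /= => /andP[_ /eqP e] ->.
by exists (a, b) => //; rewrite inE /= /edge_rel ab eE eqxx.
Qed.

Lemma edge_graph_forest k : 0 < k -> linear_forest k edge_graph.
Proof.
move=> k0; split=> [[|x [|y [|z c]]] //= | x].
  case/andP=> /and3P[xy yz _] /=.
  by rewrite (edge_rel_nbr xy yz) !inE eqxx !orbT.
have closedP (A : {set V}) : x \in A ->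
    (forall u v, edge_rel u v -> u \in A -> v \in A) ->
    component edge_graph x \subset A.
  move=> xA clA; apply/subsetP=> y; rewrite inE => /connectP[p hp ->].
  elim: p x xA hp => //= v p IH u uA /andP[uv]; apply: IH.
  exact: clA uv uA.
have [[y xy]|nex] := pselect (exists y, edge_rel x y).
  have nxy : x != y by apply: contraTneq xy => ->; rewrite edge_rel_irr.
  have eC : component edge_graph x = [set x; y].
    apply/eqP; rewrite eqEsubset closedP ?set21 //=; last first.
      move=> u v uv; rewrite !inE => /orP[] /eqP eu; subst u.
        rewrite edge_rel_sym in xy.
        by rewrite (edge_rel_nbr xy uv) eqxx orbT.
      by rewrite (edge_rel_nbr xy uv) eqxx.
    apply/subsetP=> u; rewrite !inE => /orP[] /eqP->; first exact: connect0.
    exact: connect1.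
  exists [:: x; y]; rewrite eC; split=> //=; first by rewrite inE nxy.
    by move=> u; rewrite !inE.
  move=> u v; rewrite !inE /= => /orP[] /eqP-> /orP[] /eqP->;
    by rewrite ?eqxx ?edge_rel_irr ?(negbTE nxy) ?[y == x]eq_sym
       ?(negbTE nxy) ?xy // edge_rel_sym xy.
have eC : component edge_graph x = [set x].
  apply/eqP; rewrite eqEsubset closedP ?set11 //=; last first.
    by move=> u v uv; rewrite !inE => /eqP eu; subst u; case: nex; exists v.
  by rewrite sub1set inE connect0.
exists [:: x]; rewrite eC; split=> //=; first by move=> u; rewrite !inE.
by move=> u v; rewrite !inE => /eqP-> /eqP->; rewrite /= eqxx edge_rel_irr.
Qed.

End SingleEdge.

Lemma linear_decomposition_exists k G :
  0 < k -> exists n, linear_decomposition k G n.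
Proof.
move=> k0; exists #|edges G|.
exists (fun i => edge_graph G (enum_val i)); split.
- by move=> i; apply: edge_graph_forest.
- move=> i j nij; rewrite !edges_edge_graph ?enum_valP // disjoints1 inE.
  by apply: contra nij => /eqP/enum_val_inj->.
apply/setP=> S; apply/bigcupP/idP=> [[i _]|SE].
  by rewrite edges_edge_graph ?enum_valP // inE => /eqP->; apply: enum_valP.
exists (enum_rank_in SE S) => //.
by rewrite edges_edge_graph enum_rankK_in // inE.
Qed.

Lemma laP k G : 0 < k ->
  linear_decomposition k G (la k G) /\
  forall n, linear_decomposition k G n -> la k G <= n.
Proof.
move=> k0; rewrite /la; case: pselect => [exn|nex]; last first.
  have [n dn] := linear_decomposition_exists G k0.
  by case: nex; exists n; apply/asboolP.
case: ex_minnP => m /asboolP dm min; split=> // n dn.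
by apply: min; apply/asboolP.
Qed.

End LaSpec.

(* Main.v *)
Require Import Defs.
From mathcomp Require Import all_boot ssralg zmodp zify.
From mathcomp Require Import boolp.

Set Implicit Arguments.
Unset Strict Implicit.
Unset Printing Implicit Defensive.

(** Lower bound: a linear forest has maximum degree at most 2, and a vertex of
    G o H of maximum degree has degree Delta(H) + |V(H)| Delta(G).

    Upper bound: 2-colour the vertices of a linear forest F of G by the parity
    of their position on their path, and fix a Latin square L on V(H).  For
    every symbol j, relabelling (x, a) as (x, a) or (x, L j a) according to the
    colour of x is a bijection of V(G) x V(H); pulling |V(H)| disjoint copies
    of F back along it gives a linear forest.  Every edge over F arises for
    exactly one j, because its ends have different colours.  A linear forest of
    H contributes |V(G)| disjoint copies of itself.

    Sharpness: for G = H = P_3 and k = l = 2 both bounds are equal to 4. *)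

(** * Linear forests and linear decompositions *)

Section LinearForest.
Variable V : finType.
Implicit Types G F : sgraph V.

Lemma linear_forest_leq k l F :
  k <= l -> linear_forest k F -> linear_forest l F.
Proof.
move=> kl [acF pF]; split=> // x; have [s [us sC sk sadj]] := pF x.
by exists s; split=> //; apply: leq_trans kl.
Qed.

Lemma linear_forest_degree k F x :
  linear_forest k F -> #|[set y | adj F x y]| <= 2.
Proof.
case=> _ /(_ x) [s [_ sC _ sadj]].
have xC : x \in component F x by rewrite inE connect0.
have nbr y : adj F x y -> y \in component F x.
  by move=> xy; rewrite inE connect1.
pose i := index x s.
(* At an end of the path one entry is [x] itself: [nth] defaults to [x] past the end, and [i.-1] is
   [i] when [i = 0]. Only an inclusion is needed. *)
apply: leq_trans (_ : #|[set nth x s i.+1; nth x s i.-1]| <= 2); last first.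
  by rewrite cards2; case: (_ != _).
apply/subset_leq_card/subsetP => y; rewrite !inE => xy.
have yC := nbr y xy; have ys : y \in s by rewrite sC.
move: xy; rewrite sadj // -/i => /orP[] /eqP e.
  by rewrite -e nth_index // eqxx.
by rewrite e /= nth_index // eqxx orbT.
Qed.

(** The path is chosen for the [root] of the component, so that adjacent vertices read their
    positions on the same sequence. *)
Lemma linear_forest_bipartite k F :
  linear_forest k F -> exists c : V -> bool, forall x y, adj F x y -> c x != c y.
Proof.
case=> _ /choice [S hS].
exists (fun x => odd (index x (S (root (adj F) x)))) => x y xy.
have csym : connect_sym (adj F) by apply: sym_connect_sym (@adj_sym _ _).
have xy1 : connect (adj F) x y by apply: connect1.
have -> : root (adj F) y = root (adj F) x by apply/esym/rootP.
set r := root (adj F) x; have [_ _ _ sadj] := hS r.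
have rx : x \in component F r by rewrite inE csym connect_root.
have ry : y \in component F r.
  by move: rx; rewrite !inE => rx; apply: connect_trans xy1.
by move: xy; rewrite sadj // => /orP[] /eqP-> /=; case: odd.
Qed.

(** Trades sets of edges for adjacency: disjointness of the parts becomes uniqueness of the index of
    the part. *)
Lemma linear_decompositionP k G n :
  linear_decomposition k G n <->
  exists F : 'I_n -> sgraph V,
    [/\ forall i, linear_forest k (F i),
        forall i j x y, adj (F i) x y -> adj (F j) x y -> i = j &
        forall x y, adj G x y = [exists i, adj (F i) x y]].
Proof.
split=> -[F [linF disF covF]]; exists F; split=> //.
- move=> i j x y; rewrite -!in_edges => xyi xyj; apply/eqP/negPn/negP => /disF.
  by move/disjoint_setI0/setP/(_ [set x; y]); rewrite !inE xyi xyj.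
- move=> x y; rewrite -in_edges -covF.
  by apply/bigcupP/existsP => [[i _]|[i]] xy; exists i; rewrite ?in_edges // -in_edges.
- move=> i j nij; rewrite -setI_eq0; apply/eqP/setP => S; rewrite !inE.
  apply/negP => /andP[/imsetP[[x y]]]; rewrite inE /= => xyi -> .
  by rewrite in_edges => xyj; rewrite (disF _ _ _ _ xyi xyj) eqxx in nij.
- apply/setP => S; apply/bigcupP/imsetP => [[i _ /imsetP[[x y]]]|[[x y]]];
    rewrite inE /= => xy ->.
    by exists (x, y) => //; rewrite inE /= covF; apply/existsP; exists i.
  by move: xy; rewrite covF => /existsP[i xy]; exists i => //; rewrite in_edges.
Qed.

(** Allows a structured index type, such as the sum type of the upper bound. *)
Lemma linear_decomposition_fin (I : finType) k G (F : I -> sgraph V) :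
  (forall i, linear_forest k (F i)) ->
  (forall i j x y, adj (F i) x y -> adj (F j) x y -> i = j) ->
  (forall x y, adj G x y = [exists i, adj (F i) x y]) ->
  linear_decomposition k G #|I|.
Proof.
move=> linF disF covF; apply/linear_decompositionP.
exists (F \o enum_val); split=> [i|i j x y xyi xyj|x y] /=; first exact: linF.
  exact/enum_val_inj/(disF _ _ _ _ xyi xyj).
rewrite covF; apply/existsP/existsP => -[i xy]; last by exists (enum_val i).
by exists (enum_rank i); rewrite enum_rankK.
Qed.

Lemma degree_linear_decomposition k d G n x :
  (forall F, linear_forest k F -> #|[set y | adj F x y]| <= d) ->
  linear_decomposition k G n -> #|[set y | adj G x y]| <= n * d.
Proof.
move=> degF /linear_decompositionP [F [linF _ covF]].
have -> : [set y | adj G x y] = \bigcup_(i < n) [set y | adj (F i) x y].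
  apply/setP => y; rewrite !inE covF.
  apply/existsP/bigcupP => [[i xy]|[i _]]; first by exists i; rewrite ?inE.
  by rewrite inE => xy; exists i.
apply: leq_trans (_ : \sum_(i < n) #|[set y | adj (F i) x y]| <= _).
  elim/big_ind2: _ => [|A a B b leA leB|//]; first by rewrite cards0.
  exact: leq_trans (leq_card_setU _ _) (leq_add leA leB).
rewrite -[n in n * d]card_ord -sum_nat_const.
by apply: leq_sum => i _; apply: degF.
Qed.

End LinearForest.

(** * Disjoint copies of a forest, pulled back along a bijection *)

Section Copies.
Variables (T V U : finType) (F : sgraph V) (h : T -> V * U).

(** [(h p).1] is a vertex of [F] and [(h p).2] names a copy; for bijective [h] this is the disjoint
    union of [#|U|] copies of [F]. *)
Definition copies_rel : rel T := fun p q =>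
  adj F (h p).1 (h q).1 && ((h p).2 == (h q).2).

Lemma copies_rel_sym : symmetric copies_rel.
Proof. by move=> p q; rewrite /copies_rel adj_sym eq_sym. Qed.

Lemma copies_rel_irr : irreflexive copies_rel.
Proof. by move=> p; rewrite /copies_rel adj_irr. Qed.

Definition copies : sgraph T := SGraph copies_rel_sym copies_rel_irr.

Lemma copies_path p s : path (adj copies) p s ->
  path (adj F) (h p).1 [seq (h q).1 | q <- s] /\
  {in s, forall q, (h q).2 = (h p).2}.
Proof.
elim: s p => //= q s IH p /andP[/andP[pq /eqP e]] /IH [-> epq]; rewrite pq.
by split=> // r; rewrite inE => /predU1P[->//|/epq]; rewrite e.
Qed.

(** A walk never leaves its copy, where the first coordinate determines the vertex. Hence cycles
    project to cycles of the same size, and the paths of [F] lift. *)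
Lemma copies_forest k :
  bijective h -> linear_forest k F -> linear_forest k copies.
Proof.
case=> g hK gK [acF pF]; split.
  case=> // p s /andP[cs us].
  have [cF lv] := copies_path (cs : path _ p (rcons s p)).
  have := acF [seq (h q).1 | q <- p :: s]; rewrite size_map; apply.
  apply/andP; split; first by move: cF; rewrite map_rcons.
  rewrite map_inj_in_uniq // => q r qs rs e; apply: (can_inj hK).
  have lvs t : t \in p :: s -> (h t).2 = (h p).2.
    by move=> ts; apply: lv; rewrite mem_rcons.
  by apply: injective_projections; rewrite // !lvs.
move=> p; have [s [us sC sk sadj]] := pF (h p).1.
(* [f] embeds [F] as the copy containing [p]. *)
pose f v := g (v, (h p).2).
have finj : injective f by move=> v w /(can_inj gK) [].
have memC q : q \in component copies p ->
    (h q).1 \in component F (h p).1 /\ q = f (h q).1.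
  rewrite !inE => /connectP[t pt ->]; have [ptF lv] := copies_path pt.
  split.
    apply/connectP; exists [seq (h q).1 | q <- t] => //.
    by rewrite (last_map (fun q => (h q).1)).
  rewrite /f -[LHS]hK; congr g; apply: injective_projections => //=.
  by have := mem_last p t; rewrite inE => /predU1P[-> //|/lv].
have fpath t v : path (adj F) v t -> connect (adj copies) (f v) (f (last v t)).
  elim: t v => [|w t IH] v /=; first by rewrite connect0.
  case/andP=> vw /IH; apply: connect_trans; apply: connect1.
  by rewrite /= /copies_rel /f !gK vw eqxx.
have fp : f (h p).1 = p by rewrite /f -surjective_pairing hK.
have Cf v : v \in component F (h p).1 -> f v \in component copies p.
  by rewrite !inE => /connectP[t /fpath pt ->]; rewrite -{1}fp.
exists (map f s); split; rewrite ?size_map ?map_inj_uniq //.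
  move=> q; apply/mapP/idP => [[v vs ->]|/memC [qC ->]].
    by apply: Cf; rewrite -sC.
  by exists (h q).1; rewrite ?sC.
move=> q r /memC [qC ->] /memC [rC ->]; rewrite !index_map // -sadj //.
by rewrite /= /copies_rel /f !gK /= eqxx andbT.
Qed.

End Copies.

(** The addition table of the cyclic group of order [#|W|], transported by enumeration. *)
Lemma latin_square (W : finType) : exists L : W -> W -> W,
  (forall j, injective (L j)) /\ (forall a, injective (L^~ a)).
Proof.
case E : #|W| => [|n].
  by exists (fun _ => id); split=> // a; have := fintype0 a E.
pose r (a : W) : 'I_n.+1 := cast_ord E (enum_rank a).
pose e (i : 'I_n.+1) : W := enum_val (cast_ord (esym E) i).
have rinj : injective r by move=> a b /cast_ord_inj/enum_rank_inj.
have einj : injective e by move=> i j /enum_val_inj/cast_ord_inj.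
exists (fun j a => e (r j + r a)%R); split=> [j a b|a i j] /einj.
  by move/GRing.addrI/rinj.
by move/GRing.addIr/rinj.
Qed.

(** * The lower and upper bounds *)

Section LexBounds.
Variables (V W : finType) (G : sgraph V) (H : sgraph W).

Lemma lex_degree x a :
  #|[set q | adj (lex_prod G H) (x, a) q]| =
  #|[set b | adj H a b]| + #|W| * #|[set y | adj G x y]|.
Proof.
have -> : [set q | adj (lex_prod G H) (x, a) q] =
    setX [set x] [set b | adj H a b] :|: setX [set y | adj G x y] setT.
  apply/setP=> -[y b]; rewrite !inE /= /lex_rel /= andbT orbC.
  by rewrite [x == y]eq_sym.
rewrite cardsU !cardsX cards1 mul1n cardsT [#|W| * _]mulnC.
suff -> : setX [set x] [set b | adj H a b] :&: setX [set y | adj G x y] setT = set0.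
  by rewrite cards0 subn0.
apply/setP=> -[y b]; rewrite !inE /=; apply/negP => /andP[/andP[/eqP-> _]].
by rewrite adj_irr.
Qed.

(** For empty [V] the product has no edge, while [maxdeg H] may be positive. *)
Lemma lex_la_ge k : 0 < #|V| -> 0 < k ->
  uphalf (maxdeg H + #|W| * maxdeg G) <= la k (lex_prod G H).
Proof.
move=> V0 k0; case W0 : #|W| => [|w].
  rewrite mul0n addn0 /maxdeg big1 // => a _.
  by have := fintype0 a W0.
have [x Ex] : {x | maxdeg G = #|[set y | adj G x y]|} by apply: eq_bigmax.
have [a Ea] : {a | maxdeg H = #|[set b | adj H a b]|}.
  by apply: eq_bigmax; rewrite W0.
have [dec _] := laP (lex_prod G H) k0.
rewrite Ex Ea -W0 -lex_degree leq_uphalf_double -muln2.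
by apply: degree_linear_decomposition dec => F; apply: linear_forest_degree.
Qed.

Lemma lex_linear_decomposition k l m n :
  linear_decomposition k G m -> linear_decomposition l H n ->
  linear_decomposition (maxn k l) (lex_prod G H) (m * #|W| + n).
Proof.
move=> /linear_decompositionP[A [linA disA covA]].
move=> /linear_decompositionP[B [linB disB covB]].
have [c cP] := choice (fun i => linear_forest_bipartite (linA i)).
have [L [Linj Linj']] := latin_square W.
pose h i j (p : V * W) := (p.1, if c i p.1 then p.2 else L j p.2).
have hbij i j : bijective (h i j).
  apply: injF_bij => -[x a] [y b] [<-]; case: (c i x) => [->//|/Linj->//].
(* The swap makes the vertices of [G] name the copies of a forest of [H]. *)
pose sw (p : V * W) := (p.2, p.1).
have swbij : bijective sw by exists (fun q => (q.2, q.1)); case.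
pose F (t : 'I_m * W + 'I_n) : sgraph (V * W)%type :=
  match t with
  | inl (i, j) => copies (A i) (h i j)
  | inr i => copies (B i) sw
  end.
have -> : m * #|W| + n = #|{: 'I_m * W + 'I_n}|.
  by rewrite card_sum card_prod !card_ord.
have A_irr i x : adj (A i) x x = false by apply: adj_irr.
apply: (linear_decomposition_fin (F := F)).
- case=> [[i j]|i] /=.
    exact: linear_forest_leq (leq_maxl _ _) (copies_forest (hbij i j) (linA i)).
  exact: linear_forest_leq (leq_maxr _ _) (copies_forest swbij (linB i)).
- case=> [[i j]|i] [[i' j']|i'] [x a] [y b] /= /andP[/= xy /= e] /andP[/= xy' /= e'].
  + have ei := disA _ _ _ _ xy xy'; subst i'; congr (inl (_, _)).
    (* Exactly one end is relabelled, so [j] and [j'] solve the same equation [L j b = a] or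
       [L j a = b], which has at most one solution. *)
    move: e e' (cP _ _ _ xy); case: (c i x) (c i y) => -[] // /eqP e /eqP e' _.
      by apply: (Linj' b); rewrite /= -e -e'.
    by apply: (Linj' a); rewrite /= e e'.
  (* Copies from [H] stay over one vertex of [G]; those from [G] never do. *)
  + by rewrite (eqP e') A_irr in xy.
  + by rewrite (eqP e) A_irr in xy'.
  + by rewrite (disB _ _ _ _ xy xy').
move=> [x a] [y b]; rewrite /= /lex_rel /= covA covB.
apply/orP/existsP => [[/existsP[i xy]|/andP[/eqP-> /existsP[i ab]]]|[[[i j]|i]]] /=.
(* Injectivity on a finite type gives the symbol [j] whose copy contains the edge. *)
- have surj v w : exists j, L j v = w.
    by have [g _ gK] := injF_bij (Linj' v); exists (g w); apply: gK.
  have [j Ej] : exists j, (h i j (x, a)).2 = (h i j (y, b)).2.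
    rewrite /h /=; move: (cP _ _ _ xy); case: (c i x) (c i y) => -[] // _.
    by have [j] := surj b a; exists j.
  by exists (inl (i, j)); rewrite /= /copies_rel Ej eqxx andbT.
- by exists (inr i); rewrite /= /copies_rel /= ab eqxx.
- by case/andP=> /= xy _; left; apply/existsP; exists i.
- by case/andP=> /= ab e; right; rewrite e; apply/existsP; exists i.
Qed.

Lemma lex_la_le k l : 0 < k -> 0 < l ->
  la (maxn k l) (lex_prod G H) <= la k G * #|W| + la l H.
Proof.
move=> k0 l0; have kl0 : 0 < maxn k l by rewrite leq_max k0.
apply: (laP (lex_prod G H) kl0).2.
exact: lex_linear_decomposition (laP G k0).1 (laP H l0).1.
Qed.

End LexBounds.

(** * The sharpness example *)

Definition P3_rel : rel 'I_3 := fun i j =>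
  (j == i.+1 :> nat) || (i == j.+1 :> nat).

Lemma P3_rel_sym : symmetric P3_rel.
Proof. by move=> i j; rewrite /P3_rel orbC. Qed.

Lemma P3_rel_irr : irreflexive P3_rel.
Proof. by move=> i; rewrite /P3_rel; lia. Qed.

Definition P3 : sgraph 'I_3 := SGraph P3_rel_sym P3_rel_irr.

Lemma P3_forest : linear_forest 2 P3.
Proof.
split=> [[|x [|y [|z c]]] //= | i].
  rewrite /ucycle /= /P3_rel !inE -!val_eqE /= => /andP[].
  have := ltn_ord x; have := ltn_ord y; have := ltn_ord z.
  (* Three distinct numbers below 3 are not pairwise consecutive, and four cannot be distinct. *)
  case: c => [|w c] /=; first lia.
  by rewrite !inE -!val_eqE /=; have := ltn_ord w; lia.
have P3_conn x : connect (adj P3) x (inord 1).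
  have [->|nx] := eqVneq x (inord 1); first exact: connect0.
  apply: connect1; move: nx; rewrite /= /P3_rel -val_eqE /= !inordK //.
  by have := ltn_ord x; lia.
have csym : connect_sym (adj P3) by apply: sym_connect_sym (@adj_sym _ _).
exists (enum 'I_3); split; first exact: enum_uniq.
- move=> j; rewrite mem_enum !inE; apply/esym.
  by apply: connect_trans (P3_conn i) _; rewrite csym.
- by rewrite size_enum_ord.
by move=> x y _ _; rewrite !index_enum_ord.
Qed.

Lemma P3_maxdeg : 2 <= maxdeg P3.
Proof.
apply: leq_trans (leq_bigmax (inord 1)).
apply: leq_trans (_ : #|[set ord0; ord_max : 'I_3]| <= _); first by rewrite cards2.
apply/subset_leq_card/subsetP => i; rewrite !inE /= /P3_rel inordK //.
by case/orP=> /eqP->.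
Qed.

Lemma P3_la : la 2 P3 <= 1.
Proof.
apply: (laP P3 _).2 => //; apply/linear_decompositionP.
exists (fun=> P3); split=> [_|i j _ _ _ _|x y]; first exact: P3_forest.
  by rewrite !ord1.
by apply/idP/existsP => [xy|[]//]; exists ord0.
Qed.

(** The one-sided estimates [P3_maxdeg] and [P3_la] suffice: the lower bound is at least 4 and the
    upper bound at most 4. *)
Lemma P3_sharp :
  uphalf (maxdeg P3 + #|'I_3| * maxdeg P3) = la (maxn 2 2) (lex_prod P3 P3) /\
  la (maxn 2 2) (lex_prod P3 P3) = la 2 P3 * #|'I_3| + la 2 P3.
Proof.
have := @lex_la_ge _ _ P3 P3 (maxn 2 2); rewrite card_ord => /(_ isT isT).
have := @lex_la_le _ _ P3 P3 2 2 isT isT; rewrite card_ord.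
by have := P3_la; have := P3_maxdeg; lia.
Qed.

Theorem theorem2p9 :
  (forall (V W : finType) (G : sgraph V) (H : sgraph W) (k l : nat),
     0 < #|V| -> 0 < k -> 0 < l ->
     uphalf (maxdeg H + #|W| * maxdeg G) <= la (maxn k l) (lex_prod G H) /\
     la (maxn k l) (lex_prod G H) <= la k G * #|W| + la l H)
  /\ (exists (V W : finType) (G : sgraph V) (H : sgraph W) (k l : nat),
     [/\ 0 < k, 0 < l, 0 < maxdeg G, 0 < maxdeg H &
       uphalf (maxdeg H + #|W| * maxdeg G) = la (maxn k l) (lex_prod G H)])
  /\ (exists (V W : finType) (G : sgraph V) (H : sgraph W) (k l : nat),
     [/\ 0 < k, 0 < l, 0 < maxdeg G, 0 < maxdeg H &
       la (maxn k l) (lex_prod G H) = la k G * #|W| + la l H]).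
Proof.
have P3_pos : 0 < maxdeg P3 by apply: ltnW P3_maxdeg.
have [sharpl sharpr] := P3_sharp.
split=> [V W G H k l V0 k0 l0|].
  by split; [apply: lex_la_ge; rewrite // leq_max k0 | apply: lex_la_le].
by split; exists 'I_3, 'I_3, P3, P3, 2, 2.
Qed.
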